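(* Let $q$ be an odd prime power and let $\mathbb{F}_q$ be the finite field with $q$ elements. Let $k \geq 3$ and $m$ be integers with $1 \leq m \leq q-3$, and let $h(x_1,\dots,x_k) \in \mathbb{F}_q[x_1,\dots,x_k]$ be a complete symmetric polynomial of degree $m$ in $k$ variables over $\mathbb{F}_q$. Then $$N_q(h) \geq 6\, q^{k-3}.$$
   Context: For $e \geq 0$, the homogeneous complete symmetric polynomial of degree $e$ in the variables $x_1,\dots,x_k$ is $$h_e(x_1,\dots,x_k) = \sum_{1 \leq i_1 \leq i_2 \leq \cdots \leq i_e \leq k} x_{i_1} x_{i_2} \cdots x_{i_e},$$ with $h_0 = 1$. A complete symmetric polynomial of degree $m$ over $\mathbb{F}_q$ in the variables $x_1,\dots,x_k$ is a polynomial of the form $h(x_1,\dots,x_k) = \sum_{e=0}^m a_e h_e(x_1,\dots,x_k)$ with $a_e \in \mathbb{F}_q$ and $a_m \neq 0$ (not homogeneous in general). For such $h$, $$N_q(h) = \#\{(x_1,\dots,x_k) \in \mathbb{F}_q^k \mid h(x_1,\dots,x_k) = 0\}.$$ *)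

(* Defs.v *)
From mathcomp Require Import all_boot all_order all_algebra.
From mathcomp.multinomials Require Export mpoly.

Set Implicit Arguments.
Unset Strict Implicit.
Unset Printing Implicit Defensive.

Import GRing.Theory.
Local Open Scope ring_scope.

(* h_e in the n variables 'X_0, ..., 'X_(n-1): a multi-index
   i_1 <= ... <= i_e is a nondecreasing e-tuple of 'I_n.  For e = 0 the only
   summand is the empty product, so h_0 = 1. *)
Definition mcomplete (n : nat) (R : nzRingType) (e : nat) : {mpoly R[n]} :=
  \sum_(t : e.-tuple 'I_n | sorted leq [seq val i | i <- t])
     \prod_(i <- t) 'X_i.

Definition complete_symmetric_poly (n : nat) (R : nzRingType) (m : nat)
    (h : {mpoly R[n]}) : Prop :=
  exists2 a : nat -> R,
    a m != 0 & h = \sum_(e < m.+1) a e *: mcomplete n R e.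

Definition nb_zeros (n : nat) (F : finFieldType) (h : {mpoly F[n]}) : nat :=
  #|[set x : {ffun 'I_n -> F} | h.@[x] == 0]|.

(* Main.v *)
(** Up to the factor (u - v)(u - w)(v - w), the value of h at (u, v, w, s) with s
    fixed is the collinearity determinant of three points of the graph of
    p(X) = \sum_e a_e h_(e+2)(X, s), a polynomial of degree m + 2 with
    3 <= m + 2 <= q - 1.  If no three points of this graph were collinear, the
    graph and the point at infinity of the vertical lines would form an oval and
    Segre's argument would make p agree with a quadratic polynomial on F, which
    the degree forbids.  Hence every s yields three distinct u, v, w, and their
    six permutations are zeros. *)

Require Import Defs.
From mathcomp Require Import all_boot all_order all_algebra.
From mathcomp Require Import finfield ring zify.

Set Implicit Arguments.
Unset Strict Implicit.
Unset Printing Implicit Defensive.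

Import GRing.Theory.
Local Open Scope ring_scope.

(** * Complete symmetric polynomials along a list *)

(** This is h_e at the entries of [s], expanded in powers of the first entry, so that h_e(X, s) is
    visibly a polynomial in X. *)
Fixpoint csym (R : nzRingType) (s : seq R) (e : nat) : R :=
  if s is x :: s' then \sum_(j < e.+1) csym s' (e - j) * x ^+ j else (e == 0)%:R.

Lemma csym0 (R : nzRingType) (s : seq R) : csym s 0 = 1.
Proof. by elim: s => //= x s IHs; rewrite big_ord1 subnn IHs mulr1. Qed.

Lemma csymS (R : comNzRingType) (x : R) (s : seq R) (e : nat) :
  csym (x :: s) e.+1 = csym s e.+1 + x * csym (x :: s) e.
Proof.
rewrite /= big_ord_recl subn0 mulr1; congr (_ + _).
by rewrite big_distrr; apply: eq_bigr => j _; rewrite /= subSS exprS mulrCA.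
Qed.

Arguments csym : simpl never.

(** Thus h_e(x, y, s) is the divided difference of h_(e+1)(X, s) at x and y; the recursion [csymS]
    carries the induction. *)
Lemma csym_dvd_diff (R : comNzRingType) (x y : R) (s : seq R) (e : nat) :
  (x - y) * csym [:: x, y & s] e = csym (x :: s) e.+1 - csym (y :: s) e.+1.
Proof.
elim: e => [|e IHe]; first by rewrite !csymS !csym0; ring.
by rewrite csymS mulrDr mulrCA IHe !(csymS _ s e.+1); ring.
Qed.

Lemma mcomplete_eval (n : nat) (R : comNzRingType) (x : 'I_n -> R) (e : nat) :
  (mcomplete n R e).@[x] = csym [seq x i | i <- enum 'I_n] e.
Proof.
(* Only multi-indices with all entries >= b, so that induction on n - b applies. *)
pose P (b e : nat) := \sum_(t : e.-tuple 'I_n | path leq b [seq val i | i <- t])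
  \prod_(i <- t) x i.
have P0 b : P b 0 = 1.
  rewrite /P (big_pred1 [tuple]) ?big_nil // => t.
  by rewrite tuple0 /= eqxx.
have PS b d : P b d.+1 = \sum_(i < n | (b <= i)%N) x i * P i d.
  rewrite /P (reindex (fun p : 'I_n * d.-tuple 'I_n => [tuple of p.1 :: p.2])) /=; last first.
    exists (fun t => (thead t, [tuple of behead t])) => [[i t] _|t _].
      by congr pair; apply: val_inj.
    by rewrite /= -tuple_eta.
  rewrite -(pair_big_dep (fun i : 'I_n => b <= i)%N
    (fun (i : 'I_n) (t : d.-tuple 'I_n) => path leq i [seq val i | i <- t])
    (fun (i : 'I_n) (t : d.-tuple 'I_n) => \prod_(j <- i :: t) x j)) /=.
  apply: eq_bigr => i _; rewrite big_distrr /=.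
  by apply: eq_bigr => t _; rewrite big_cons.
have PE b d : (b <= n)%N -> P b d = csym [seq x i | i <- drop b (enum 'I_n)] d.
  elim: d b => [|d IHd] b; first by rewrite P0 csym0.
  move: {2}(n - b)%N (leqnn (n - b)) => c.
  elim: c b => [|c IHc] b hc hb.
    have -> : b = n by lia.
    rewrite PS drop_oversize ?size_enum_ord //= big1 // => i.
    by rewrite leqNgt ltn_ord.
  have [hbn|hbn] := leqP n b; first by apply: IHc; lia.
  have hd : drop b (enum 'I_n) = Ordinal hbn :: drop b.+1 (enum 'I_n).
    rewrite (drop_nth (Ordinal hbn)) ?size_enum_ord //; congr cons.
    by apply: val_inj; rewrite /= nth_enum_ord.
  (* Either b is the first index or all indices exceed b: this is the recursion [csymS] for [P]. *)
  rewrite hd map_cons csymS -map_cons -hd -IHd // -IHc; [|lia|lia].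
  rewrite PS (bigD1 (Ordinal hbn)) //= addrC PS; congr (_ + _).
  by apply: eq_bigl => i; rewrite -val_eqE /= ltn_neqAle andbC eq_sym.
rewrite -[enum 'I_n]drop0 -PE // /P /mcomplete raddf_sum /=.
apply: eq_big => [t|t _]; first by case: (tval t).
by rewrite rmorph_prod /=; apply: eq_bigr => i _; rewrite mevalXU.
Qed.

(** * Segre's argument for graphs without three collinear points *)

(** Subtracting [f b] leaves a permutation of F that sends b to 0, so the product does not depend on
    f. *)
Lemma finField_prod_sub_inj (F : finFieldType) (f : F -> F) (b : F) :
  injective f -> \prod_(x | x != b) (f x - f b) = \prod_(v : F | v != 0) v.
Proof.
move=> f_inj; pose g x := f x - f b.
have g_inj : injective g by move=> x y /addIr /f_inj.
rewrite [RHS](reindex_inj g_inj); apply: eq_bigl => x.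
by rewrite /g subr_eq0 (inj_eq f_inj).
Qed.

Lemma odd_finField_nat2_neq0 (F : finFieldType) : odd #|F| -> 2%:R != 0 :> F.
Proof.
move=> hodd; apply/negP => /eqP h2.
have ch2 : 2%N \in [pchar F] by rewrite inE /= h2 eqxx.
move: hodd; rewrite (card_pprimeChar ch2) oddX orbF => /eqP e0.
by have := finNzRing_gt1 F; rewrite (card_pprimeChar ch2) e0.
Qed.

Section Arc.

Variables (F : finFieldType) (g : F -> F).

Let slope (a x : F) := (g x - g a) / (x - a).

Hypothesis two_neq0 : 2%:R != 0 :> F.
Hypothesis slope_inj : forall a x y,
  x != a -> y != a -> x != y -> slope a x != slope a y.

(** The chords through the point at [a] are fewer than the elements of F; a slope left over serves
    as tangent slope. *)
Lemma arc_tangent_slope (a : F) : exists t, forall x, x != a -> slope a x != t.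
Proof.
have hlt : (#|[set slope a x | x in [set~ a]]| < #|F|)%N.
  apply: leq_ltn_trans (leq_imset_card _ _) _.
  by rewrite cardsC1 ltn_predL; apply/card_gt0P; exists a.
have /existsP[t ht] : [exists t, t \notin [set slope a x | x in [set~ a]]].
  rewrite -negb_forall; apply/negP => /forallP hall.
  by move: hlt; rewrite ltnNge => /negP; apply; apply: subset_leq_card; apply/subsetP.
exists t => x hx; apply: contraNneq ht => <-.
by apply: imset_f; rewrite !inE.
Qed.

(* Segre's lemma of tangents, the third point of the oval being the common
   point at infinity of the vertical lines. *)
Lemma arc_tangent_sum (t : F -> F) :
  (forall a x, x != a -> slope a x != t a) ->
  forall a b, a != b -> t a + t b = 2%:R * slope a b.
Proof.
move=> ht.
(* The second divided difference of [g] at a, b, x, hence symmetric in them. *)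
pose d a b x := (slope a x - slope a b) / (x - b).
pose D a b := \prod_(x | (x != b) && (x != a)) d a b x.
have C_neq0 : \prod_(v : F | v != 0) v != 0 by apply/prodf_neq0.
(* The slopes at a, completed by the tangent slope at a itself, permute F. Comparing their product
   with that of the identity cancels the factors x - b. *)
have hD a b : a != b -> D a b * (t a - slope a b) = a - b.
  move=> hab; pose f x := if x == a then t a else slope a x.
  have f_inj : injective f.
    move=> x y; rewrite /f; case: (eqVneq x a) => [->|hx]; case: (eqVneq y a) => [->|hy] //.
    - by move=> e; have := ht a y hy; rewrite e eqxx.
    - by move=> e; have := ht a x hx; rewrite e eqxx.
    by move=> e; apply/eqP; apply: contraT => /(slope_inj hx hy); rewrite e eqxx.
  have := finField_prod_sub_inj b f_inj.
  have [fa fb] : f a = t a /\ f b = slope a b.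
    by rewrite /f eqxx eq_sym (negPf hab).
  rewrite (bigD1 a) //= fa fb.
  have -> : \prod_(x | (x != b) && (x != a)) (f x - slope a b) =
      D a b * \prod_(x | (x != b) && (x != a)) (x - b).
    rewrite -big_split; apply: eq_bigr => x /andP[hxb hxa] /=.
    by rewrite /d /f (negPf hxa) divfK // subr_eq0.
  have := finField_prod_sub_inj b (@inj_id F); rewrite (bigD1 a) //= => hC.
  rewrite -hC => h.
  have hp : \prod_(x | (x != b) && (x != a)) (x - b) != 0.
    by apply/prodf_neq0 => x /andP[hx _]; rewrite subr_eq0.
  by apply: (mulIf hp); rewrite -h; ring.
have dC a b x : a != b -> x != a -> x != b -> d a b x = d b a x.
  move=> hab hxa hxb; rewrite /d /slope; field.
  by rewrite !subr_eq0 hab hxa hxb eq_sym hab.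
have DC a b : a != b -> D a b = D b a.
  move=> hab; rewrite /D; apply: eq_big => [x|x /andP[hxb hxa]]; first exact: andbC.
  exact: dC.
move=> a b hab.
have hba : b != a by rewrite eq_sym.
have sC : slope b a = slope a b.
  by rewrite /slope; field; rewrite !subr_eq0 hab hba.
(* [D] is symmetric while a - b changes sign, so the two identities add up to zero. *)
have h1 := hD _ _ hab; have h2 := hD _ _ hba.
rewrite -(DC a b hab) sC in h2.
have D_neq0 : D a b != 0.
  apply/eqP => D0; move: h1; rewrite D0 mul0r => /esym/eqP.
  by rewrite subr_eq0 (negPf hab).
apply: (mulfI D_neq0).
apply/eqP; rewrite -subr_eq0; apply/eqP.
by transitivity ((a - b) + (b - a)); [rewrite -h1 -h2; ring | ring].
Qed.

(** The tangent relations among 0, 1, x force t to be affine in x, and the relation for 0, x then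
    determines [g x]. *)
Lemma arc_quadratic : exists c0 c1 c2 : F, forall x, g x = c0 + c1 * x + c2 * x ^+ 2.
Proof.
have [t ht] := fin_all_exists arc_tangent_slope.
have hs := arc_tangent_sum ht.
have hg a b : 2%:R * (g b - g a) = (t a + t b) * (b - a).
  have [->|hab] := eqVneq a b; first by rewrite !subrr !mulr0.
  by rewrite (hs a b hab) /slope -mulrA divfK // subr_eq0 eq_sym.
(* [t] acts as the derivative of g: c1 = t 0 and 2 c2 = t 1 - t 0. *)
exists (g 0), (t 0), ((t 1 - t 0) / 2%:R) => x.
have [->|hx0] := eqVneq x 0; first by rewrite expr2 !mulr0 !addr0.
have h01 := hg 0 1; have h0x := hg 0 x; have h1x := hg 1 x.
have htx : t x = (1 - x) * t 0 + x * t 1.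
  (* The values of g cancel, and t x keeps the coefficient x - (x - 1) = 1. *)
  have : (t 0 + t x) * (x - 0) - (t 1 + t x) * (x - 1) = (t 0 + t 1) * (1 - 0).
    by rewrite -h01 -h0x -h1x; ring.
  move=> h; have : t x = (t 0 + t 1) * (1 - 0) - t 0 * x + t 1 * (x - 1).
    by rewrite -h; ring.
  by move=> ->; ring.
apply: (mulfI two_neq0); apply/eqP; rewrite -subr_eq0; apply/eqP.
transitivity (2%:R * (g x - g 0) - (2%:R * t 0 * x + (t 1 - t 0) * x ^+ 2)).
  by field.
by rewrite h0x htx; ring.
Qed.

End Arc.

(** Otherwise p agrees on F with some r of degree at most 2, and p - r, nonzero of degree below
    [#|F|], vanishes on all of F. *)
Lemma collinear_of_poly (F : finFieldType) (p : {poly F}) :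
  2%:R != 0 :> F -> (3 < size p <= #|F|)%N ->
  exists a x y : F, [/\ x != a, y != a, x != y &
    (p.[x] - p.[a]) / (x - a) = (p.[y] - p.[a]) / (y - a)].
Proof.
move=> two0 /andP[hp3 hpF].
pose Q a x y := [&& x != a, y != a, x != y &
  (p.[x] - p.[a]) / (x - a) == (p.[y] - p.[a]) / (y - a)].
have [/existsP[a /existsP[x /existsP[y /and4P[h1 h2 h3 /eqP h4]]]]|hn] :=
  boolP [exists a, exists x, exists y, Q a x y].
  by exists a, x, y.
have [|c0 [c1 [c2 hc]]] := @arc_quadratic F (horner p) two0.
  move=> a x y hx hy hxy; apply: contra hn => he.
  by apply/existsP; exists a; apply/existsP; exists x; apply/existsP; exists y; apply/and4P.
pose r : {poly F} := Poly [:: c0; c1; c2].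
have hr : (size r <= 3)%N by apply: size_Poly.
have spr : size (p - r) = size p by rewrite size_polyDl // size_polyN (leq_ltn_trans hr).
have pr0 : p - r != 0 by rewrite -size_poly_gt0 spr (ltn_trans _ hp3).
have hroots : all (root (p - r)) (enum F).
  by apply/allP => x _; rewrite rootE hornerD hornerN hc horner_Poly /=; apply/eqP; ring.
have := max_poly_roots pr0 hroots (enum_uniq F).
by rewrite spr -cardE ltnNge hpF.
Qed.

(** * Zeros with a fixed tail *)

Section FixedTail.

Variables (F : finFieldType) (a : nat -> F) (m : nat) (s : seq F).
Hypothesis two_neq0 : 2%:R != 0 :> F.
Hypotheses (m_gt0 : (0 < m)%N) (m_le : (m + 3 <= #|F|)%N) (am_neq0 : a m != 0).

Let H (u v w : F) := \sum_(e < m.+1) a e * csym [:: u, v, w & s] e.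
(** The coefficient of X^j in h_(e+2)(X, s) is h_(e+2-j)(s); the shift by 2 makes up for two divided
    differences. *)
Let p : {poly F} := \sum_(e < m.+1) a e *: \poly_(j < e.+3) csym s (e.+2 - j).

Lemma tail_poly_horner (u : F) : p.[u] = \sum_(e < m.+1) a e * csym (u :: s) e.+2.
Proof.
rewrite horner_sum; apply: eq_bigr => e _.
by rewrite hornerZ horner_poly.
Qed.

(** Only e = m reaches degree m + 2, with coefficient a_m h_0(s) = a_m. *)
Lemma tail_poly_size : size p = m.+3.
Proof.
apply/anti_leq/andP; split.
  apply: leq_trans (size_sum _ _ _) _; apply/bigmax_leqP => e _.
  apply: leq_trans (size_scale_leq _ _) _; apply: leq_trans (size_poly _ _) _.
  by rewrite !ltnS -ltnS ltn_ord.
rewrite ltnNge; apply: contra am_neq0 => /leq_sizeP/(_ _ (leqnn _)) <-.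
rewrite coef_sum (bigD1 ord_max) //= coefZ coef_poly ltnSn subnn csym0.
rewrite big1 ?addr0 ?mulr1 ?eqxx // => e he.
have lt_em : (e < m)%N by move: he (ltn_ord e); rewrite -val_eqE /=; lia.
by rewrite coefZ coef_poly !ltnS leqNgt lt_em mulr0.
Qed.

(** [H] is the second divided difference of [p]: in each term the difference in u, v is taken first,
    then those in u, w and in v, w. *)
Lemma tail_divided_difference (u v w : F) :
  (u - v) * (u - w) * (v - w) * H u v w =
  p.[u] * (v - w) + p.[v] * (w - u) + p.[w] * (u - v).
Proof.
rewrite !tail_poly_horner !mulr_suml -!big_split mulr_sumr; apply: eq_bigr => e _ /=.
have huv := csym_dvd_diff u v (w :: s) e.
have huw := csym_dvd_diff u w s e.+1; have hvw := csym_dvd_diff v w s e.+1.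
transitivity (a e * ((v - w) * ((u - w) * csym [:: u, w & s] e.+1)
  - (u - w) * ((v - w) * csym [:: v, w & s] e.+1))).
  transitivity (a e * (v - w) * (u - w) * ((u - v) * csym [:: u, v, w & s] e)).
    by ring.
  by rewrite huv; ring.
by rewrite huw hvw; ring.
Qed.

Lemma tail_zeros : (6 <= #|[set t : F * F * F | (H t.1.1 t.1.2 t.2 == 0)%R]|)%N.
Proof.
have [|w [u [v [huw hvw huv hc]]]] := @collinear_of_poly F p two_neq0.
  (* Both bounds on m enter here: 3 < m + 3 <= [#|F|]. *)
  by rewrite tail_poly_size; lia.
have d_neq0 x y : x != y -> x - y != 0 by rewrite subr_eq0.
have hcol : p.[u] * (v - w) + p.[v] * (w - u) + p.[w] * (u - v) = 0.
  transitivity ((p.[u] - p.[w]) / (u - w) * (u - w) * (v - w) -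
                (p.[v] - p.[w]) / (v - w) * (v - w) * (u - w)).
    by rewrite !divfK ?d_neq0 //; ring.
  by rewrite hc; ring.
have H0 x y z : x != y -> x != z -> y != z ->
    p.[x] * (y - z) + p.[y] * (z - x) + p.[z] * (x - y) = 0 -> H x y z == 0.
  move=> hxy hxz hyz; rewrite -tail_divided_difference => /eqP.
  by rewrite !mulf_eq0 !subr_eq0 (negPf hxy) (negPf hxz) (negPf hyz).
pose L := [:: (u, v, w); (u, w, v); (v, u, w); (v, w, u); (w, u, v); (w, v, u)].
have hwu : w != u by rewrite eq_sym.
have hwv : w != v by rewrite eq_sym.
have hvu : v != u by rewrite eq_sym.
have uL : uniq L.
  rewrite /L /= !inE !xpair_eqE !eqxx (negPf huw) (negPf hvw) (negPf huv).
  by rewrite (negPf hwu) (negPf hwv) (negPf hvu).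
rewrite -[6%N]/(size L) -(card_uniqP uL); apply/subset_leq_card/subsetP => t.
(* The determinant is alternating: even permutations keep it and odd ones negate it. *)
rewrite !inE => /or4P[|||/or3P[]] /eqP -> /=; apply: H0 => //.
- by rewrite -[RHS]oppr0 -hcol; ring.
- by rewrite -[RHS]oppr0 -hcol; ring.
- by rewrite -hcol; ring.
- by rewrite -hcol; ring.
- by rewrite -[RHS]oppr0 -hcol; ring.
Qed.

End FixedTail.

(* Summation over all tails *)
Local Close Scope ring_scope.

Theorem theorem1p4 (q : nat) (F : finFieldType) (hq : #|F| = q)
    (hodd : odd q) (k m : nat) (hk : 3 <= k) (hm1 : 1 <= m) (hm2 : m <= q - 3)
    (h : {mpoly F[k]}) (hh : complete_symmetric_poly m h) :
  6 * q ^ (k - 3) <= nb_zeros h.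
Proof.
case: k hk h hh => [|[|[|n]]] // _ h [a am0 ->].
have two0 : (2%:R != 0 :> F)%R by apply: odd_finField_nat2_neq0; rewrite hq.
pose Z (s : n.-tuple F) := [set t : F * F * F |
  (\sum_(e < m.+1) a e * csym [:: t.1.1, t.1.2, t.2 & s] e == 0)%R].
have hZ s : 6 <= #|Z s| by apply: tail_zeros => //; rewrite hq; lia.
(* Gluing three coordinates to a tail is injective, so pairs of a tail and a triple in its [Z] are
   counted instead of zeros. *)
pose f (u : n.-tuple F * (F * F * F)) : {ffun 'I_n.+3 -> F} :=
  [ffun i => tnth [tuple of [:: u.2.1.1, u.2.1.2, u.2.2 & u.1]] i].
have fE u : [seq f u i | i <- enum 'I_n.+3] = [:: u.2.1.1, u.2.1.2, u.2.2 & u.1].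
  by rewrite (eq_map (ffunE _)) map_tnth_enum.
have f_inj : injective f.
  move=> [s [[x y] z]] [s' [[x' y'] z']] e.
  have := fE (s, (x, y, z)); rewrite e fE /= => -[-> -> -> /val_inj ->] //.
apply: (@leq_trans #|[set u | u.2 \in Z u.1]|).
  (* There are q^(k-3) tails, each contributing at least 6 pairs. *)
  rewrite -[n.+3 - 3]/(n - 0) subn0 -hq -(card_tuple n) mulnC -sum_nat_const -sum1_card.
  rewrite (eq_bigl (fun u => true && (u.2 \in Z u.1))); last by move=> u; rewrite inE.
  rewrite -(pair_big_dep xpredT (fun s t => t \in Z s) (fun _ _ => 1)) /=.
  by apply: leq_sum => s _; rewrite sum1_card.
rewrite -(card_imset _ f_inj); apply/subset_leq_card/subsetP => _ /imsetP[u hu ->].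
move: hu; rewrite !inE => /eqP hu; apply/eqP; rewrite -[RHS]hu raddf_sum /=.
by apply: eq_bigr => e _; rewrite mevalZ mcomplete_eval fE.
Qed.
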